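(* Let $\tau>0$ and let $f\colon\mathbb{R}\to\mathbb{R}$ be a function of bounded variation (on each compact interval), continuous from the right, which is either constant or periodic with minimal period $\tau$. Let $U\colon Y\to Y$ be the monodromy operator of $x(t)=f(t)x(t-\tau)$ and let $U_{\mathbb{C}}\colon Y_{\mathbb{C}}\to Y_{\mathbb{C}}$ be its complexification. Then the continuous spectrum $\sigma_c(U_{\mathbb{C}})$ of $U_{\mathbb{C}}$ is empty.
   Context: $Y:=NBV([-\tau,0];\mathbb{R})$ is the Banach space, with the total variation norm, of functions $\phi\colon[-\tau,0]\to\mathbb{R}$ of bounded variation that are continuous from the right and satisfy $\phi(0)=0$. Its complexification is $Y_{\mathbb{C}}\cong NBV([-\tau,0];\mathbb{C})$ (the same with complex values, total variation norm). For a function $x$ the segment of $x$ at $t$ is $x_t(\theta):=x(t+\theta)$, $\theta\in[-\tau,0]$. For $\phi\in Y$, let $x(\cdot;\phi)$ be the unique solution of the initial value problem $x(t)=f(t)x(t-\tau)$ for $t\ge 0$, $x_0=\phi$. The monodromy operator is $U\phi:=x_\tau(\cdot;\phi)$. Convention on the normalization at $0$: the initial condition prescribes $x(\theta)=\phi(\theta)$ for $\theta\in[-\tau,0)$, the equation prescribes $x(t)$ for $t\ge 0$, and segments are regarded as elements of $Y$ by assigning them the value $0$ at $\theta=0$; so $(U\phi)(\theta)=x(\tau+\theta;\phi)$ for $\theta\in[-\tau,0)$ and $(U\phi)(0)=0$. The complexified operator is $U_{\mathbb{C}}(\phi_{\Re}+\mathrm{i}\phi_{\Im}):=U\phi_{\Re}+\mathrm{i}U\phi_{\Im}$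 for $\phi_{\Re},\phi_{\Im}\in Y$. The continuous spectrum $\sigma_c(U_{\mathbb{C}})$ is the set of $\lambda\in\mathbb{C}$ such that $U_{\mathbb{C}}-\lambda I_{Y_{\mathbb{C}}}$ is injective and not surjective, but has range dense in $Y_{\mathbb{C}}$. *)

(* Defs.v *)
From HB Require Import structures.
From mathcomp Require Import all_boot all_order all_algebra.
From mathcomp Require Import complex.
From mathcomp Require Import all_classical all_reals all_analysis.
From mathcomp Require Import ring.

Set Implicit Arguments.
Unset Strict Implicit.
Unset Printing Implicit Defensive.
Import Order.TTheory GRing.Theory Num.Theory.
Import numFieldNormedType.Exports.
Local Open Scope classical_set_scope.
Local Open Scope ring_scope.

(* The variation of the library is that of functions R -> R; the codomain is
   here an arbitrary numFieldType K, in order to cover K := R[i].  At K := R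
   these notions are convertible to those of the library. *)
Section variation.
Context {R : realType} {K : numFieldType}.
Implicit Types (a b : R) (f g : R -> K) (s : seq R).

Definition kvariation a b f s : K :=
  let F := f \o nth b (a :: s) in \sum_(0 <= n < size s) `|F n.+1 - F n|.

Definition kvariations a b f : set K :=
  [set kvariation a b f s | s in itv_partition a b].

Definition kbounded_variation a b f := has_ubound (kvariations a b f).

Lemma kvariation_ge0 a b f s : 0 <= kvariation a b f s.
Proof. exact/sumr_ge0. Qed.

Lemma kvariationD a b f g s :
  kvariation a b (f + g) s <= kvariation a b f s + kvariation a b g s.
Proof.
rewrite /kvariation -big_split/=; apply: ler_sum => k _.
apply: le_trans (ler_normD _ _).
by rewrite !fctE opprD addrACA.
Qed.

Lemma kvariationZ a b (c : K) f s :
  kvariation a b (c *: f) s = `|c| * kvariation a b f s.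
Proof.
rewrite /kvariation mulr_sumr; apply: eq_bigr => k _.
by rewrite !fctE -scalerBr normrZ.
Qed.

Lemma kvariation1 a b f : kvariation a b f [:: b] = `|f b - f a|.
Proof. by rewrite /kvariation/= big_nat1. Qed.

Lemma kvariation2 a b f x : kvariation a b f [:: x; b] =
  `|f x - f a| + `|f b - f x|.
Proof. by rewrite /kvariation/= big_nat_recl// big_nat1. Qed.

End variation.

Lemma kbounded_variationE (R : realType) (a b : R) (f : R -> R) :
  kbounded_variation a b f = bounded_variation a b f.
Proof. by []. Qed.

(* A function on [-tau, 0] is encoded by its extension by 0 to R; right
   continuity of the extension at 0 then follows from phi 0 = 0. *)
Section nbv.
Context {R : realType} (K : numFieldType) (tau : R).

Definition is_nbv (phi : R -> K) :=
  [/\ forall t, t \notin `[- tau, 0] -> phi t = 0,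
      phi 0 = 0,
      forall t, t \in `[- tau, 0] -> phi @ t^'+ --> phi t &
      kbounded_variation (- tau) 0 phi].

Definition nbv : {pred R -> K} := [pred phi | `[< is_nbv phi >]].

Lemma nbv_submod_closed : submod_closed nbv.
Proof.
split.
  rewrite inE; split => // [t _|]; first exact: cvg_cst.
  exists 0 => _ [s _ <-]; rewrite /kvariation big1// => i _ /=.
  by rewrite subrr normr0.
move=> c f g; rewrite !inE => -[f1 f2 f3 [M f4]] [g1 g2 g3 [N g4]]; split.
- by move=> t ht; rewrite !fctE f1// g1// scaler0 addr0.
- by rewrite !fctE f2 g2 scaler0 addr0.
- by move=> t ht; apply: cvgD; [apply: cvgZr; exact: f3|exact: g3].
- exists (`|c| * M + N) => _ [s ps <-].
  apply: le_trans (kvariationD _ _ _ _ _) _.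
  rewrite kvariationZ lerD//; last by apply: g4; exists s.
  by apply: ler_wpM2l => //; apply: f4; exists s.
Qed.

HB.instance Definition _ := GRing.isSubmodClosed.Build _ _ nbv
  nbv_submod_closed.

Record NBV := MkNBV { nbv_fun :> R -> K ; nbvP : nbv_fun \in nbv }.

HB.instance Definition _ := [isSub for nbv_fun].
HB.instance Definition _ := [Choice of NBV by <:].
HB.instance Definition _ := [SubChoice_isSubLmodule of NBV by <:].

End nbv.

(* The total variation as a real number.  The variations are elements of K that
   are nonnegative, hence real; nu stands for the identity of R or for the real
   part R[i] -> R. *)
Section tvnorm.
Context {R : realType} {K : numFieldType} (nu : K -> R).
Hypothesis nuD : {morph nu : x y / x + y}.
Hypothesis nu_le : {homo nu : x y / x <= y}.
Hypothesis nu_normM : forall c x : K, nu (`|c| * x) = nu `|c| * nu x.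
Hypothesis nu_norm_eq0 : forall x : K, nu `|x| = 0 -> x = 0.
Variable tau : R.
Implicit Types phi psi : NBV K tau.

Definition tvnorm phi : R :=
  sup [set nu v | v in kvariations (- tau) 0 (phi : R -> K)].

Lemma nbv_out phi t : t \notin `[- tau, 0] -> phi t = 0.
Proof. by move: t; have := nbvP phi; rewrite inE => -[]. Qed.

Lemma nbv0 phi : phi 0 = 0.
Proof. by have := nbvP phi; rewrite inE => -[]. Qed.

Lemma nbv_bv phi : kbounded_variation (- tau) 0 (phi : R -> K).
Proof. by have := nbvP phi; rewrite inE => -[]. Qed.

Lemma nbv_eq0 phi : tau <= 0 -> phi = 0.
Proof.
move=> tau0; apply/val_inj/funext => t; rewrite [RHS](_ : _ = 0)//=.
have [->|t0] := eqVneq t 0; first exact: nbv0.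
apply: nbv_out; apply: contra t0; rewrite in_itv/= => /andP[h1 h2].
by rewrite eq_le h2 (le_trans _ h1)// oppr_ge0.
Qed.

Lemma nu0 : nu 0 = 0.
Proof. by apply: (addrI (nu 0)); rewrite -nuD !addr0. Qed.

Lemma has_sup_tvnorm phi : 0 < tau ->
  has_sup [set nu v | v in kvariations (- tau) 0 (phi : R -> K)].
Proof.
move=> tau0; split.
  exists (nu (kvariation (- tau) 0 (phi : R -> K) [:: 0])).
  apply: imageP; exists [:: 0] => //; apply: itv_partition1.
  by rewrite oppr_lt0.
have [M hM] := nbv_bv phi; exists (nu M) => _ [v hv <-].
exact/nu_le/hM.
Qed.

Lemma tvnorm_ub phi s : 0 < tau -> itv_partition (- tau) 0 s ->
  nu (kvariation (- tau) 0 (phi : R -> K) s) <= tvnorm phi.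
Proof.
move=> tau0 hs; have [_ hu] := has_sup_tvnorm phi tau0.
by apply: ub_le_sup => //; apply: imageP; exists s.
Qed.

Lemma tvnorm_le phi M : 0 < tau ->
  (forall s, itv_partition (- tau) 0 s ->
    nu (kvariation (- tau) 0 (phi : R -> K) s) <= M) ->
  tvnorm phi <= M.
Proof.
move=> tau0 h; have [ne _] := has_sup_tvnorm phi tau0.
by apply: ge_sup => // _ [_ [s hs <-] <-]; exact: h.
Qed.

Lemma tvnorm0 : tvnorm 0 = 0.
Proof.
have v0 s : kvariation (- tau) 0 (\val (0 : NBV K tau)) s = 0.
  by rewrite /kvariation big1// => i _ /=; rewrite subrr normr0.
have [tau0|tau0] := leP tau 0.
  rewrite /tvnorm; have [[_ [v hv _]]|] := pselect ([set nu v | v in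
    kvariations (- tau) 0 (\val (0 : NBV K tau))] !=set0); last first.
    by move/set0P/negP; rewrite negbK => /eqP ->; rewrite sup0.
  rewrite (_ : [set _ | _ in _] = [set 0]) ?sup1//; apply/seteqP; split.
    by move=> _ [_ [s _ <-] <-] /=; rewrite v0 nu0.
  by move=> _ ->; exists v => //; case: hv => s _ <-; rewrite v0 nu0.
apply/eqP; rewrite eq_le tvnorm_le//=; last by move=> s _; rewrite v0 nu0.
rewrite -[leLHS]nu0 -(v0 [:: 0]) tvnorm_ub//; apply: itv_partition1.
by rewrite oppr_lt0.
Qed.

Lemma ler_tvnormD phi psi : tvnorm (phi + psi) <= tvnorm phi + tvnorm psi.
Proof.
have [tau0|tau0] := leP tau 0.
  by rewrite (nbv_eq0 phi tau0) (nbv_eq0 psi tau0) addr0 tvnorm0 addr0.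
apply: tvnorm_le => // s hs.
apply: le_trans (nu_le (kvariationD _ _ _ _ _)) _.
by rewrite nuD lerD// tvnorm_ub.
Qed.

Lemma tvnormZ_le (c : K) phi : tvnorm (c *: phi) <= nu `|c| * tvnorm phi.
Proof.
have [tau0|tau0] := leP tau 0.
  by rewrite (nbv_eq0 phi tau0) scaler0 tvnorm0 mulr0.
apply: tvnorm_le => // s hs; rewrite kvariationZ nu_normM.
apply: ler_wpM2l; last exact: tvnorm_ub.
by rewrite -nu0; apply: nu_le.
Qed.

Lemma tvnormZ (c : K) phi : tvnorm (c *: phi) = nu `|c| * tvnorm phi.
Proof.
apply/eqP; rewrite eq_le tvnormZ_le/=.
have [->|c0] := eqVneq c 0; first by rewrite normr0 nu0 mul0r scale0r tvnorm0.
have nuc0 : nu `|c| != 0 by apply: contra_neq c0; exact: nu_norm_eq0.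
have nuc_gt0 : 0 < nu `|c| by rewrite lt_def nuc0 -nu0 nu_le.
rewrite -ler_pdivlMl// -[in leLHS](scale1r phi) -(mulVf c0) -scalerA.
apply: le_trans (tvnormZ_le _ _) _.
suff -> : nu `|c^-1| = (nu `|c|)^-1 by [].
apply: (mulfI nuc0); rewrite -nu_normM -normrM divff// mulfV//.
have h1 : nu `|c| = nu `|c| * nu 1 by rewrite -nu_normM mulr1.
by apply: (mulfI nuc0); rewrite normr1 -h1 mulr1.
Qed.

Lemma tvnorm_eq0 phi : tvnorm phi = 0 -> phi = 0.
Proof.
have [tau0|tau0] := leP tau 0; first by rewrite (nbv_eq0 phi tau0).
move=> phi0; apply/val_inj/funext => t; rewrite [RHS](_ : _ = 0)//=.
have ltau : - tau < 0 by rewrite oppr_lt0.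
have [/andP[t1 t2]|] := boolP (- tau <= t <= 0); last first.
  by move=> ht; apply: nbv_out; rewrite in_itv.
have [->|t_neq0] := eqVneq t 0; first exact: nbv0.
have {t_neq0}t2 : t < 0 by rewrite lt_neqAle t_neq0.
have le0 (x : K) : nu `|x| <= 0 -> x = 0.
  by move=> h; apply: nu_norm_eq0; apply/eqP; rewrite eq_le h -nu0 nu_le.
suff: phi 0 - phi t = 0 by move/subr0_eq; rewrite nbv0.
apply: le0; rewrite -[leRHS]phi0.
move: t1; rewrite le_eqVlt => /predU1P[<-|t1].
  rewrite -(kvariation1 (- tau) 0 (phi : R -> K)); apply: tvnorm_ub => //; exact: itv_partition1.
apply: (@le_trans _ _ (nu (kvariation (- tau) 0 (phi : R -> K) [:: t; 0]))).
  by apply: nu_le; rewrite kvariation2 lerDr.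
apply: tvnorm_ub => //; split => //=; by rewrite t1 t2.
Qed.

End tvnorm.

Lemma tvnormE (R : realType) (tau : R) (phi : NBV R tau) : 0 < tau ->
  tvnorm id phi = fine (total_variation (- tau) 0 phi).
Proof.
move=> tau0; rewrite /tvnorm image_id /total_variation ereal_sup_EFin//.
  exact: (nbv_bv phi).
by apply: variations_neq0; rewrite oppr_lt0.
Qed.

Section spaces.
Context {R : realType} (tau : R).

Definition Y : Type := NBV R tau.
HB.instance Definition _ := GRing.Lmodule.on Y.

Fact ler_normYD (x y : Y) : tvnorm id (x + y) <= tvnorm id x + tvnorm id y.
Proof.
exact: (@ler_tvnormD R R id (fun _ _ => erefl) (fun _ _ => id) tau x y).
Qed.

Fact normYZ (c : R) (x : Y) : tvnorm id (c *: x) = `|c| * tvnorm id x.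
Proof.
apply: (@tvnormZ R R id (fun _ _ => erefl) (fun _ _ => id)) => //.
by move=> y /eqP; rewrite normr_eq0 => /eqP.
Qed.

Fact normY_eq0 (x : Y) : tvnorm id x = 0 -> x = 0.
Proof.
apply: (@tvnorm_eq0 R R id (fun _ _ => erefl) (fun _ _ => id)).
by move=> y /eqP; rewrite normr_eq0 => /eqP.
Qed.

HB.instance Definition _ := Lmodule_isNormed.Build R Y ler_normYD normYZ normY_eq0.

Definition YC : Type := NBV R[i] tau.
HB.instance Definition _ := GRing.Lmodule.on YC.

Definition normYC (x : YC) : R[i] := (tvnorm (@complex.Re R) x)%:C%C.

Let ReD : {morph @complex.Re R : x y / x + y}.
Proof. by move=> [a b] [c d]. Qed.

Let Re_le : {homo @complex.Re R : x y / x <= y}.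
Proof. by move=> x y; rewrite lecE => /andP[]. Qed.

Let Re_normM (c x : R[i]) :
  complex.Re (`|c| * x) = complex.Re `|c| * complex.Re x.
Proof. by case: c x => [a b] [c d] /=; rewrite mul0r subr0. Qed.

Let Re_norm_eq0 (x : R[i]) : complex.Re `|x| = 0 -> x = 0.
Proof. by move=> /= h; apply: ComplexField.Normc.eq0_normc. Qed.

Fact ler_normYCD (x y : YC) : normYC (x + y) <= normYC x + normYC y.
Proof. by rewrite /normYC -rmorphD/= lecR; exact: ler_tvnormD. Qed.

Fact normYCZ (c : R[i]) (x : YC) : normYC (c *: x) = `|c| * normYC x.
Proof.
rewrite /normYC tvnormZ// rmorphM/=; congr (_ * _).
Qed.

Fact normYC_eq0 (x : YC) : normYC x = 0 -> x = 0.
Proof. by move=> /complexI; exact: tvnorm_eq0. Qed.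

HB.instance Definition _ :=
  Lmodule_isNormed.Build R[i] YC ler_normYCD normYCZ normYC_eq0.

End spaces.

(* The initial condition is imposed on [-tau, 0) only, the equation giving x(0);
   the values x(t) for t < -tau are left unconstrained. *)
Section ivp.
Context {R : realType} (tau : R) (f : R -> R).

Definition ivp (phi : R -> R) : set (R -> R) := [set x |
  (forall t, t \in `[- tau, 0[ -> x t = phi t) /\
  (forall t, 0 <= t -> x t = f t * x (t - tau))].

Hypothesis tau_gt0 : 0 < tau.
Implicit Types (phi x y : R -> R).

Let step_ind (P : R -> Prop) : (forall t, t < 0 -> P t) ->
  (forall t, 0 <= t -> P (t - tau) -> P t) -> forall t, P t.
Proof.
move=> P0 PS t; have [n] : exists n : nat, t < n%:R * tau.
  by exists (Num.truncn (t / tau)).+1; rewrite -ltr_pdivrMr// (real_truncnS_gt (num_real _)).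
elim: n t => [t|n ih t tn]; first by rewrite mul0r; exact: P0.
have [/P0//|t0] := ltP t 0; apply: PS => //; apply: ih.
by rewrite ltrBlDr; rewrite -natr1 mulrDl mul1r in tn.
Qed.

Lemma ivp_unique phi x y : ivp phi x -> ivp phi y ->
  forall t, - tau <= t -> x t = y t.
Proof.
move=> [x1 x2] [y1 y2]; elim/step_ind => [t t0 taut|t t0 ih _].
  by rewrite x1 ?y1// in_itv/= taut.
by rewrite x2// y2// ih// lerBrDr addrC subrr.
Qed.

Lemma ivp_exists phi : ivp phi !=set0.
Proof.
pose F := fix F n t := if t < 0 then phi t else
  if n is n'.+1 then f t * F n' (t - tau) else 0.
have FS n m t : t < n%:R * tau -> t < m%:R * tau -> F n t = F m t.
  elim: n m t => [|n ih] [|m] t //=; rewrite ?mul0r.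
  - by move=> t0; rewrite t0.
  - by move=> _ t0; rewrite t0.
  rewrite -!natr1 !mulrDl !mul1r -!ltrBlDr => tn tm.
  by case: ifP => // _; congr (_ * _); exact: ih.
pose N t := (Num.truncn (t / tau)).+1.
have tN t : t < (N t)%:R * tau by rewrite -ltr_pdivrMr// (real_truncnS_gt (num_real _)).
exists (fun t => F (N t) t); split => [t|t t0].
  by rewrite in_itv/= => /andP[_ ->].
rewrite -[LHS]/(F (N t) t).
suff <- : F (Num.truncn (t / tau)) (t - tau) = F (N (t - tau)) (t - tau).
  by rewrite /= ltNge t0.
apply: FS => //.
by have := tN t; rewrite {1}/N -natr1 mulrDl mul1r -ltrBlDr.
Qed.

Definition solution phi : R -> R := get (ivp phi).

Lemma solutionP phi : ivp phi (solution phi).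
Proof. by have [x hx] := ivp_exists phi; exact: getI hx. Qed.

End ivp.

(* The segment x_t as an element of Y: the value at 0 is normalized to 0. *)
Definition segment (R : realType) (tau : R) (x : R -> R) (t : R) : R -> R :=
  fun theta => if theta \in `[- tau, 0[ then x (t + theta) else 0.

Section monodromy.
Context {R : realType} (tau : R) (f : R -> R).
Hypothesis tau_gt0 : 0 < tau.
Hypothesis f_bv : forall a b, a <= b -> bounded_variation a b f.
Hypothesis f_rc : right_continuous f.
Implicit Types phi : Y tau.

Lemma segment_solutionE phi :
  segment tau (solution tau f phi) tau = (fun t => f (tau + t) * phi t).
Proof.
have [s1 s2] := solutionP f tau_gt0 phi.
apply/funext => t; rewrite /segment; case: ifPn => [ht|].
  rewrite s2; last by move: ht; rewrite in_itv/= => /andP[+ _]; rewrite lerNl -subr_ge0 opprK.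
  by rewrite addrAC subrr add0r s1.
have [->|t0 ht] := eqVneq t 0; first by rewrite nbv0 mulr0.
rewrite nbv_out ?mulr0//; apply: contra ht; rewrite !in_itv/= => /andP[-> /=].
by rewrite lt_neqAle t0.
Qed.

Let bv_bounded (a b : R) (g : R -> R) : a <= b -> bounded_variation a b g ->
  exists2 M, 0 <= M & forall t, a <= t <= b -> `|g t| <= M.
Proof.
move=> ab [V hV]; exists (`|g a| + `|V|) => [|t /andP[at_ tb]].
  by rewrite addr_ge0.
suff : `|g t - g a| <= V.
  move=> h; rewrite -[g t](subrK (g a)) (le_trans (ler_normD _ _))// addrC.
  by rewrite lerD2l (le_trans h)// ler_norm.
move: at_; rewrite le_eqVlt => /predU1P[<-|at_].
  rewrite subrr normr0; move: ab; rewrite le_eqVlt => /predU1P[ab|ab].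
    by apply: hV; rewrite ab variationsxx.
  apply: le_trans (hV _ (variations_variation _ (itv_partition1 ab))).
  exact: variation_ge0.
move: tb; rewrite le_eqVlt => /predU1P[tb|tb].
  rewrite tb in at_ *; rewrite -(kvariation1 a b (g : R -> R)); apply: hV; exists [:: b] => //.
  exact: itv_partition1.
apply: (@le_trans _ _ (kvariation a b g [:: t; b])).
  by rewrite kvariation2 lerDl.
by apply: hV; exists [:: t; b] => //; split => //=; rewrite at_ tb.
Qed.

Let bvM (a b : R) (g h : R -> R) : a <= b ->
  bounded_variation a b g -> bounded_variation a b h ->
  bounded_variation a b (fun t => g t * h t).
Proof.
move=> ab gbv hbv.
have [M M0 gM] := bv_bounded ab gbv; have [N N0 hN] := bv_bounded ab hbv.
have [V hV] := gbv; have [W hW] := hbv.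
exists (N * V + M * W) => _ [s ps <-].
apply: (@le_trans _ _ (N * variation a b g s + M * variation a b h s)); last first.
  by rewrite lerD// ler_wpM2l//; [apply: hV|apply: hW]; exists s.
rewrite /variation !mulr_sumr -big_split/= !big_nat; apply: ler_sum => i /andP[_ si].
set x := nth b (a :: s) i; set y := nth b s i.
have xab : a <= x <= b.
  by rewrite itv_partition_nth_ge ?itv_partition_nth_le// ltnS ltnW.
have yab : a <= y <= b.
  have -> : y = nth b (a :: s) i.+1 by [].
  by rewrite itv_partition_nth_ge ?itv_partition_nth_le// ltnS.
have -> : g y * h y - g x * h x = h y * (g y - g x) + g x * (h y - h x) by ring.
apply: le_trans (ler_normD _ _) _; rewrite !normrM lerD// ler_wpM2r//.
- exact: hN.
- exact: gM.
Qed.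

Let bv_shift : bounded_variation (- tau) 0 (fun t => f (tau + t)).
Proof.
have [V hV] := f_bv (ltW tau_gt0); exists V => _ [s [ps /eqP ls] <-].
suff -> : variation (- tau) 0 (fun t => f (tau + t)) s =
    variation 0 tau f [seq tau + t | t <- s].
  apply: hV; exists [seq tau + t | t <- s] => //; split.
    rewrite -(subrr tau) path_map; apply: sub_path ps => x y /= xy.
    by rewrite ltrD2l.
  by rewrite -(subrr tau) last_map ls addr0.
rewrite /variation size_map; apply: eq_big_nat => i /andP[_ si] /=.
have e : 0 :: [seq tau + t | t <- s] = [seq tau + t | t <- - tau :: s].
  by rewrite /= subrr.
by rewrite e !(nth_map 0)//= 1?ltnS 1?ltnW// !(set_nth_default 0)//= ltnS ltnW.
Qed.

Lemma segment_solution_nbv phi :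
  segment tau (solution tau f phi) tau \in nbv tau.
Proof.
have := nbvP phi; rewrite !inE segment_solutionE => -[p1 p2 p3 p4]; split.
- by move=> t /p1 ->; rewrite mulr0.
- by rewrite p2 mulr0.
- move=> t ht; apply: cvgM; last exact: p3.
  apply: (@cvg_comp _ _ _ (fun z : R => tau + z) f _ ((tau + t)^'+)); last exact: f_rc.
  move=> A /= [e e0 he]; exists e => //= z /= hz tz; apply: he => /=.
    by rewrite opprD addrACA subrr add0r.
  by rewrite ltrD2l.
- by apply: bvM => //; rewrite oppr_le0 ltW.
Qed.

Definition monodromy phi : Y tau := MkNBV (segment_solution_nbv phi).

End monodromy.

Section complexification.
Context {R : realType} (tau : R).
Local Notation Re := (@complex.Re R).
Local Notation Im := (@complex.Im R).

Let Re_le (z : R[i]) : (`|Re z|%:C <= `|z|)%C.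
Proof. exact: normc_ge_Re. Qed.

Let Im_le (z : R[i]) : (`|Im z|%:C <= `|z|)%C.
Proof.
have := Re_le (z * 'i%C); rewrite ReiNIm normrN normrM.
suff -> : `|'i%C : R[i]| = 1 by rewrite mulr1.
by rewrite normc_def/= expr0n/= add0r expr1n sqrtr1.
Qed.

Let Re_le' (z : R[i]) : `|Re z| <= Re `|z|.
Proof. by rewrite -lecR RRe_real ?normr_real//; exact: Re_le. Qed.

Let Im_le' (z : R[i]) : `|Im z| <= Re `|z|.
Proof. by rewrite -lecR RRe_real ?normr_real//; exact: Im_le. Qed.

Let normC_le (z : R[i]) :
  (`|z| <= (`|Re z| + `|Im z|)%:C)%C.
Proof.
rewrite normc_def lecR -[leRHS]ger0_norm ?addr_ge0// -sqrtr_sqr.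
apply: ler_wsqrtr; rewrite sqrrD !real_normK ?num_real//.
by rewrite addrAC lerDl mulrn_wge0// mulr_ge0.
Qed.

Let C : numFieldType := R[i].

Let cvgC (F : set_system R) (FF : Filter F) (g : R -> C) (l : C) :
  g @ F --> l <-> (Re \o g @ F --> Re l) /\
                  (Im \o g @ F --> Im l).
Proof.
split=> [/cvgrPdist_lt gl|[/cvgrPdist_lt gl1 /cvgrPdist_lt gl2]].
  split; apply/cvgrPdist_lt => e e0.
  - have /gl : 0 < e%:C%C by rewrite ltcR.
    apply: filterS => t /= h; rewrite -raddfB -ltcR.
    exact: le_lt_trans (Re_le _) h.
  - have /gl : 0 < e%:C%C by rewrite ltcR.
    apply: filterS => t /= h; rewrite -raddfB -ltcR.
    exact: le_lt_trans (Im_le _) h.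
apply/cvgrPdist_lt => e e0.
have eE : e = (Re e)%:C%C by rewrite RRe_real// gtr0_real.
have e2 : 0 < Re e / 2 by rewrite divr_gt0// -ltcR -eE.
near=> t; rewrite eE; apply: le_lt_trans (normC_le _) _.
rewrite ltcR [ltRHS]splitr ltrD//.
- by rewrite raddfB; near: t; exact: gl1.
- by rewrite raddfB; near: t; exact: gl2.
Unshelve. all: by end_near. Qed.

Let kvariation_Re (a b : R) (g : R -> R[i]) s :
  kvariation a b (Re \o g) s <= Re (kvariation a b g s).
Proof.
rewrite /kvariation raddf_sum; apply: ler_sum => i _ /=.
rewrite -raddfB; exact: Re_le'.
Qed.

Let kvariation_Im (a b : R) (g : R -> R[i]) s :
  kvariation a b (Im \o g) s <= Re (kvariation a b g s).
Proof.
rewrite /kvariation raddf_sum; apply: ler_sum => i _ /=.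
rewrite -raddfB; exact: Im_le'.
Qed.

Let kvariation_ReIm (a b : R) (g : R -> R[i]) s :
  kvariation a b g s <= (kvariation a b (Re \o g) s +
                         kvariation a b (Im \o g) s)%:C%C.
Proof.
rewrite /kvariation -big_split/= rmorph_sum; apply: ler_sum => i _ /=.
by rewrite -!raddfB; exact: normC_le.
Qed.

Let nbvC (g : R -> R[i]) : g \in nbv tau <->
  (Re \o g \in nbv tau) /\ (Im \o g \in nbv tau).
Proof.
rewrite !inE; split.
  move=> [g1 g2 g3 [M gM]]; split; split.
  - by move=> t /g1 /= ->.
  - by rewrite /= g2.
  - by move=> t /g3 /cvgC[].
  - exists (Re M) => _ [s hs <-]; apply: le_trans (kvariation_Re _ _ _ _) _.
    have : kvariation (- tau) 0 g s <= M by apply: gM; exists s.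
    by rewrite lecE => /andP[].
  - by move=> t /g1 /= ->.
  - by rewrite /= g2.
  - by move=> t /g3 /cvgC[].
  - exists (Re M) => _ [s hs <-]; apply: le_trans (kvariation_Im _ _ _ _) _.
    have : kvariation (- tau) 0 g s <= M by apply: gM; exists s.
    by rewrite lecE => /andP[].
move=> [[g1 g2 g3 [M gM]] [h1 h2 h3 [N hN]]]; split.
- move=> t ht; apply/eqP; rewrite eq_complex/=.
  by move: (g1 _ ht) (h1 _ ht) => /= -> ->; rewrite !eqxx.
- apply/eqP; rewrite eq_complex/=.
  by move: g2 h2 => /= -> ->; rewrite !eqxx.
- by move=> t ht; apply/cvgC; split; [exact: g3|exact: h3].
- exists (M + N)%:C%C => _ [s hs <-]; apply: le_trans (kvariation_ReIm _ _ _ _) _.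
  by rewrite lecR lerD//; [apply: gM|apply: hN]; exists s.
Qed.

(* ReY, ImY and joinY identify the complexification of Y with YC. *)
Fact re_subproof (phi : YC tau) : Re \o phi \in nbv tau.
Proof. by have /nbvC[] := nbvP phi. Qed.

Fact im_subproof (phi : YC tau) : Im \o phi \in nbv tau.
Proof. by have /nbvC[] := nbvP phi. Qed.

Fact join_subproof (phi psi : Y tau) :
  (fun t => (phi t +i* psi t)%C) \in nbv tau.
Proof. by apply/nbvC; split; [exact: (nbvP phi)|exact: (nbvP psi)]. Qed.

Definition ReY (phi : YC tau) : Y tau := MkNBV (re_subproof phi).
Definition ImY (phi : YC tau) : Y tau := MkNBV (im_subproof phi).
Definition joinY (phi psi : Y tau) : YC tau := MkNBV (join_subproof phi psi).

Lemma joinYE phi : joinY (ReY phi) (ImY phi) = phi.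
Proof. by apply/val_inj/funext => t /=; case: (phi t). Qed.

Lemma ReY_join phi psi : ReY (joinY phi psi) = phi.
Proof. exact/val_inj. Qed.

Lemma ImY_join phi psi : ImY (joinY phi psi) = psi.
Proof. exact/val_inj. Qed.

Definition complexify (U : Y tau -> Y tau) (phi : YC tau) : YC tau :=
  joinY (U (ReY phi)) (U (ImY phi)).

End complexification.

Definition continuous_spectrum (K : numFieldType) (V : normedModType K)
    (A : V -> V) : set K :=
  [set lambda | let B := fun v => A v - lambda *: v in
    [/\ injective B, range B <> setT & dense (range B)]].

Definition minimal_period (R : realType) (f : R -> R) (tau : R) : Prop :=
  [/\ 0 < tau, periodic f tau &
      forall p, 0 < p < tau -> ~ periodic f p].

(* Main.v *)
(* U is multiplication by t |-> f (tau + t), so U_C - lambda is multiplication by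
   some h, and [h 1_[-tau, 0[] lies in YC, being the image of 1_[-tau, 0[.  The
   total variation norm dominates the sup norm: if the range is dense, some h psi
   is uniformly within 1/2 of 1_[-tau, 0[, whence |h| |psi| >= 1/2 on [-tau, 0[
   with psi bounded.  Then h is bounded away from 0 there, dividing by h preserves
   YC, and the range is everything. *)
Require Import Defs.
From HB Require Import structures.
From mathcomp Require Import all_boot all_order all_algebra.
From mathcomp Require Import complex.
From mathcomp Require Import all_classical all_reals all_analysis.
From mathcomp Require Import ring.

Set Implicit Arguments.
Unset Strict Implicit.
Unset Printing Implicit Defensive.
Import Order.TTheory GRing.Theory Num.Theory.
Import numFieldNormedType.Exports.
Local Open Scope classical_set_scope.
Local Open Scope ring_scope.

(** As [phi 0 = 0], the value [|phi t|] is the single increment from [t] to [0], hence part of one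
    variation. An arbitrary upper bound [M] replaces the supremum, which need not exist in [K]. *)
Lemma nbv_norm_le (R : realType) (K : numFieldType) (tau : R)
    (phi : NBV K tau) (M : K) (t : R) : 0 < tau ->
  ubound (kvariations (- tau) 0 (phi : R -> K)) M -> `|phi t| <= M.
Proof.
move=> tau0 hM; have ntau0 : - tau < 0 by rewrite oppr_lt0.
have M0 : 0 <= M.
  apply: le_trans (kvariation_ge0 (- tau) 0 (phi : R -> K) [:: 0]) _.
  by apply: hM; exists [:: 0] => //; exact: itv_partition1.
have [|/(nbv_out phi) ->] := boolP (t \in `[- tau, 0]); last by rewrite normr0.
rewrite in_itv/= => /andP[t1 t2].
have [->|t_neq0] := eqVneq t 0; first by rewrite nbv0 normr0.
have {t_neq0}t2 : t < 0 by rewrite lt_neqAle t_neq0.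
rewrite -normrN -[- _]add0r -(nbv0 phi).
(* Partitions are strictly increasing from [- tau], so [[:: t; 0]] is one only for [t] beyond the
   left endpoint. *)
move: t1; rewrite le_eqVlt => /predU1P[<-|t1].
  rewrite -(kvariation1 (- tau) 0 (phi : R -> K)); apply: hM.
  by exists [:: 0] => //; exact: itv_partition1.
apply: (@le_trans _ _ (kvariation (- tau) 0 (phi : R -> K) [:: t; 0])).
  by rewrite kvariation2 lerDr.
by apply: hM; exists [:: t; 0] => //; split => //=; rewrite t1 t2.
Qed.

(* At t = 0 the quotient is the junk value 0 / 0 = 0, as membership in nbv
   requires. *)
Lemma nbv_div (R : realType) (K : numFieldType) (tau : R)
    (phi h : NBV K tau) (c : K) : 0 < tau ->
  (forall t, t \in `[- tau, 0[ -> 1 <= c * `|h t|) ->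
  (fun t => phi t / h t) \in nbv tau.
Proof.
move=> tau0 hc; have ntau0 : - tau < 0 by rewrite oppr_lt0.
have [M hM] := nbv_bv phi; have [W hW] := nbv_bv h.
have phiM t : `|phi t| <= M by exact: nbv_norm_le.
have c0 : 0 <= c.
  have /hc : - tau \in `[- tau, 0[ by rewrite in_itv/= lexx.
  have [->|hn0] := eqVneq (h (- tau)) 0; first by rewrite normr0 mulr0 ler10.
  move=> /(le_trans ler01); rewrite pmulr_lge0//.
  by rewrite normr_gt0.
have h_neq0 t : t \in `[- tau, 0[ -> h t != 0.
  by move=> /hc; apply: contraTneq => ->; rewrite normr0 mulr0 ler10.
have hV t : t \in `[- tau, 0[ -> `|(h t)^-1| <= c.
  move=> ht; rewrite normfV -[leLHS]mul1r ler_pdivrMr ?normr_gt0 ?h_neq0//.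
  exact: hc.
have in_co t : t \in `[- tau, 0] -> t != 0 -> t \in `[- tau, 0[.
  by rewrite !in_itv/= => /andP[-> /=] t0 tn0; rewrite lt_neqAle tn0.
rewrite inE; split.
- by move=> t /(nbv_out phi) ->; rewrite mul0r.
- by rewrite nbv0 mul0r.
(* At [0], where [h] vanishes, right continuity comes from [phi] being [0] on the right of [0]. *)
- move=> t ht; have [->|t0] := eqVneq t 0.
    rewrite nbv0 mul0r; apply: cvg_near_cst; near=> x.
    rewrite nbv_out ?mul0r// in_itv/= negb_and -!ltNge.
    by apply/orP; right; near: x; exact: nbhs_right_gt.
  have := nbvP phi; have := nbvP h; rewrite !inE => -[_ _ hr _] [_ _ pr _].
  apply: cvgM; first exact: pr.
  by apply: cvgV; [exact/h_neq0/in_co|exact: hr].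
have dist x y : x \in `[- tau, 0] -> y \in `[- tau, 0] ->
    `|phi y / h y - phi x / h x| <=
    c * `|phi y - phi x| + M * c * c * `|h y - h x|.
  move=> hx hy.
  have M0 : 0 <= M by exact: le_trans (phiM 0).
  have rest0 : 0 <= M * c * c * `|h y - h x| by rewrite !mulr_ge0.
  (* An endpoint equal to [0] is treated apart: [phi] and the quotient both vanish there, so the
     first term of the bound suffices. *)
  have [y0|/(in_co _ hy) {}hy] := eqVneq y 0.
    rewrite {}y0 in rest0 *; rewrite (nbv0 phi) mul0r !sub0r !normrN.
    have [x0|/(in_co _ hx) {}hx] := eqVneq x 0.
      by rewrite {}x0 in rest0 *; rewrite (nbv0 phi) mul0r normr0 mulr0 add0r.
    by rewrite normrM mulrC -[leLHS]addr0 lerD// ler_wpM2r// hV.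
  have [x0|/(in_co _ hx) {}hx] := eqVneq x 0.
    rewrite {}x0 in rest0 *; rewrite (nbv0 phi) mul0r !subr0.
    by rewrite normrM mulrC -[leLHS]addr0 lerD// ler_wpM2r// hV.
  (* Each increment now carries only factors bounded by [c] (inverses of [h]) or [M] (values of
     [phi]). *)
  have -> : phi y / h y - phi x / h x =
      (h y)^-1 * (phi y - phi x) + phi x * (h y)^-1 * (h x)^-1 * (h x - h y).
    by field; rewrite !h_neq0.
  apply: le_trans (ler_normD _ _) _; rewrite !normrM (distrC (h x)) lerD//.
    by rewrite ler_wpM2r// hV.
  by rewrite ler_wpM2r// ler_pM ?mulr_ge0 ?hV// ler_pM ?hV.
exists (c * M + M * c * c * W) => _ [s hs <-].
apply: (@le_trans _ _ (c * kvariation (- tau) 0 (phi : R -> K) s +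
    M * c * c * kvariation (- tau) 0 (h : R -> K) s)); last first.
  have M0 : 0 <= M by exact: le_trans (phiM 0).
  by rewrite lerD// ler_wpM2l ?mulr_ge0//; [apply: hM|apply: hW]; exists s.
rewrite /kvariation !mulr_sumr -big_split/= !big_nat.
apply: ler_sum => i /andP[_ si]; apply: dist.
  by rewrite in_itv/= itv_partition_nth_ge ?itv_partition_nth_le// ltnS ltnW.
rewrite in_itv/= (itv_partition_nth_ge (m := i.+1) si hs).
exact: (itv_partition_nth_le (m := i.+1) si hs).
Unshelve. all: by end_near. Qed.

(** Variations are nonnegative, so they equal their real parts, and the norm bounds them all in
    [R[i]]. *)
Lemma YC_norm_le (R : realType) (tau : R) (phi : YC tau) (t : R) : 0 < tau ->
  `|phi t| <= `|phi|.
Proof.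
move=> tau0; apply: (nbv_norm_le t tau0) => _ [s hs <-].
rewrite -(RRe_real (ger0_real (kvariation_ge0 _ _ _ _))) lecR.
apply: tvnorm_ub => // x y; by rewrite lecE => /andP[].
Qed.

Lemma YC_dist_le (R : realType) (tau : R) (phi psi : YC tau) (t : R) :
  0 < tau -> `|phi t - psi t| <= `|phi - psi|.
Proof. by move=> tau0; exact: (YC_norm_le (phi - psi)). Qed.

Lemma indicator_nbv (R : realType) (tau : R) : 0 < tau ->
  (fun t => (t \in `[- tau, 0[)%:R : R) \in nbv tau.
Proof.
move=> tau0; rewrite inE; split.
- move=> t; rewrite !in_itv/= negb_and => /orP[/negbTE -> //|].
  by rewrite -ltNge => t0; rewrite [t < 0]ltNge (ltW t0) andbF.
- by rewrite in_itv/= ltxx andbF.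
- move=> t; rewrite in_itv/= => /andP[t1 t2].
  apply: cvg_near_cst; move: t2; rewrite le_eqVlt => /predU1P[->|t2]; near=> x.
    have x0 : 0 < x by near: x; exact: nbhs_right_gt.
    by rewrite !in_itv/= ltxx andbF [x < 0]ltNge (ltW x0) andbF.
  have tx : t < x by near: x; exact: nbhs_right_gt.
  rewrite !in_itv/= t1 t2 (le_trans t1 (ltW tx))/=.
  by have -> // : x < 0 by near: x; exact: nbhs_right_lt.
have step : {in `[- tau, 0] &, {homo (fun t => (t \in `[- tau, 0[)%:R : R) :
    m n /~ n <= m}}.
  move=> x y; rewrite !in_itv/= => /andP[-> _] /andP[-> _] /= xy.
  by rewrite ler_nat; case: (ltP y 0) => // y0; rewrite (le_lt_trans xy).
(* For a nonincreasing function the sum telescopes to one value on all partitions; that value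
   becomes the bound. *)
rewrite kbounded_variationE; eexists => _ [s hs <-].
by rewrite (nonincreasing_variation step hs).
Unshelve. all: by end_near. Qed.

(** The multiplier is real, so it acts alike on real and imaginary parts. *)
Lemma complexify_monodromyE (R : realType) (tau : R) (f : R -> R)
    (tau_gt0 : 0 < tau)
    (f_bv : forall a b : R, a <= b -> bounded_variation a b f)
    (f_rc : right_continuous f) (phi : YC tau) (t : R) :
  complexify (monodromy tau_gt0 f_bv f_rc) phi t = (f (tau + t))%:C%C * phi t.
Proof.
have UE (psi : Y tau) : monodromy tau_gt0 f_bv f_rc psi t = f (tau + t) * psi t.
  exact: (congr1 (@^~ t) (segment_solutionE f tau_gt0 psi)).
transitivity ((f (tau + t) * ReY phi t) +i* (f (tau + t) * ImY phi t))%C.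
  by rewrite -!UE.
by rewrite /=; case: (phi t) => a b; simpc.
Qed.

Theorem theorem6 (R : realType) (tau : R) (f : R -> R)
    (tau_gt0 : 0 < tau)
    (f_bv : forall a b : R, a <= b -> bounded_variation a b f)
    (f_rc : right_continuous f)
    (f_period : (exists c : R, forall t : R, f t = c) \/ minimal_period f tau) :
  continuous_spectrum (complexify (monodromy tau_gt0 f_bv f_rc)) = set0.
Proof.
rewrite -subset0 => lambda [].
(* It remains to derive surjectivity from density, against [range B <> setT]. *)
set B := (fun v => _ - _) => _ + B_dense; apply.
pose h t : R[i] := (f (tau + t))%:C%C - lambda.
have BE (phi : YC tau) t : B phi t = h t * phi t.
  by rewrite mulrBl -(complexify_monodromyE tau_gt0 f_bv f_rc).
pose one : YC tau := joinY (MkNBV (indicator_nbv tau_gt0)) 0.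
have oneE t : t \in `[- tau, 0[ -> one t = 1 by move=> /= ->.
have B1E t : t \in `[- tau, 0[ -> B one t = h t.
  by move=> ht; rewrite BE oneE// mulr1.
have half_gt0 : (0 : R[i]) < 2^-1 by rewrite invr_gt0.
have [_ [/[swap] [[psi _ <-]] near_one]] :
    ball one 2^-1 `&` range B !=set0.
  by apply: B_dense; [exists one; exact: ballxx|exact: ball_open].
(* The constant comes from [1/2 <= |h t| |psi t|] and the bound of [|psi t|] by the norm of
   [psi]. *)
have {near_one}one_psi t : t \in `[- tau, 0[ -> 1 <= (2 * `|psi|) * `|h t|.
  move=> ht; move: near_one; rewrite -ball_normE/= => psi1.
  have close : `|1 - h t * psi t| <= 2^-1.
    rewrite -[X in `|X - _|](oneE _ ht) -BE.
    by apply: le_trans (ltW psi1); exact: YC_dist_le.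
  have half_le : 2^-1 <= `|h t * psi t|.
    have := ler_normD (1 - h t * psi t) (h t * psi t).
    rewrite subrK normr1 => /le_trans/(_ (lerD close (lexx _))).
    by rewrite -lerBlDl [X in X - _]splitr mul1r addrK.
  rewrite -mulrA -ler_pdivrMl// mulr1 mulrC.
  apply: le_trans half_le _.
  by rewrite normrM ler_wpM2l// YC_norm_le.
apply/seteqP; split=> // phi _.
have B1c t : t \in `[- tau, 0[ -> 1 <= (2 * `|psi|) * `|B one t|.
  by move=> ht; rewrite B1E// one_psi.
(* The divisor is [B one], which lies in [YC] and agrees with [h] on the half-open interval. *)
exists (MkNBV (nbv_div phi tau_gt0 B1c)) => //.
apply/val_inj/funext => t; transitivity (h t * (phi t / B one t)).
  exact: BE.
have [ht|ht] := boolP (t \in `[- tau, 0[).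
  rewrite B1E// mulrC divfK//.
  by have := one_psi _ ht; apply: contraTneq => ->; rewrite normr0 mulr0 ler10.
(* Off the half-open interval both sides vanish with [phi], whatever the divisor is. *)
suff phi0 : phi t = 0 by rewrite [RHS]phi0 phi0 mul0r mulr0.
have [->|t0] := eqVneq t 0; first exact: nbv0.
apply: nbv_out; apply: contra ht; rewrite !in_itv/= => /andP[-> /=].
by rewrite lt_neqAle t0.
Qed.
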